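(* Let $G$ be a finite group and let $\alpha$ be an automorphism of $G$ such that $|S_\alpha|>|S_{\mathrm{id}}|$. Then there is an irreducible complex representation of $G$ that is non-real, i.e. that is not realizable over $\mathbb{R}$.
   Context: For an automorphism $\alpha$ of a finite group $G$, $S_\alpha=\{g\in G\mid \alpha(g)=g^{-1}\}$; $\mathrm{id}$ denotes the identity automorphism, so $S_{\mathrm{id}}=\{g\in G\mid g^2=1\}$. A complex representation is called realizable over $\mathbb{R}$ (real) if it is isomorphic to the complexification of a representation of $G$ on a real vector space. *)

(* Defs.v *)
From mathcomp Require Import all_boot all_order all_algebra all_fingroup all_character.
From mathcomp Require Import complex reals.

Set Implicit Arguments.
Unset Strict Implicit.
Unset Printing Implicit Defensive.

Import GroupScope.

(* An automorphism of G is an element of Aut G, i.e. a permutation of the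
   ambient type gT that is a morphism on G and is the identity outside G; the
   identity automorphism is the unit 1 of the permutation group. *)
Definition inverted_set (gT : finGroupType) (G : {group gT})
    (alpha : {perm gT}) : {set gT} :=
  [set g in G | alpha g == g^-1].

(* The complexification of a matrix representation is its entrywise image
   under the embedding R -> R[i]. *)
Definition complexification (R : realType) (gT : finGroupType)
    (G : {group gT}) (n : nat) (rR : mx_representation R G n) :
    mx_representation R[i] G n :=
  map_repr (real_complex R) rR.

Definition realizable_over_reals (R : realType) (gT : finGroupType)
    (G : {group gT}) (n : nat) (rG : mx_representation R[i] G n) : Prop :=
  exists (m : nat) (rR : mx_representation R G m),
    mx_rsim rG (complexification rR).

(* Main.v *)
(* Evaluating the regular character at [alpha g * g] and summing over [g] gives
   [|G| |S_alpha| = \sum_i d_i \sum_g chi_i (alpha g * g)].  If [chi_i] is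
   afforded by a real representation [rho], Schur averaging shows that the inner
   sum is [0] when [rho] and [rho \o alpha] are not isomorphic, and otherwise
   [|G| / d_i] times the trace of the square of an intertwiner orthogonal
   for the invariant scalar product, hence at most [|G|]; for [alpha = 1] it is
   exactly [|G|].  So if all irreducible representations are real, then
   [|S_alpha| <= |S_1|]. *)

Require Import Defs.
From mathcomp Require Import all_boot all_order all_algebra all_fingroup all_character.
From mathcomp Require Import pgroup boolp complex reals.

Import GroupScope.

(** * Schur averaging and the invariant form of a real representation *)

Section RealRepresentation.

Import Order.TTheory GRing.Theory Num.Theory.
Local Open Scope ring_scope.

Lemma mxtrace_delta (F : fieldType) n (i j : 'I_n) :
  \tr (delta_mx i j : 'M[F]_n) = (i == j)%:R.
Proof.
rewrite /mxtrace (bigD1 i) //= big1 ?addr0 ?mxE ?eqxx // => k /negPf ki.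
by rewrite mxE ki.
Qed.

(** Puts matrix units between [X] and [Y], so that summing over the group turns the right-hand side
    into entries of Schur averages. *)
Lemma mxtrace_mul_trmx_delta (F : fieldType) n (X P Y Q : 'M[F]_n) :
  \tr (X *m P *m Y^T *m Q)
    = \sum_b \sum_d (Q *m (X *m delta_mx b d *m Y) *m P^T) d b.
Proof.
have MdN (M N : 'M[F]_n) b d : (M *m delta_mx b d *m N) d b = M d b * N d b.
  rewrite mxE (bigD1 d) //= big1 ?addr0 => [|j /negPf jd]; last first.
    by rewrite mxE big1 ?mul0r // => k _; rewrite mxE jd andbF mulr0.
  rewrite mxE (bigD1 b) //= big1 ?addr0 ?mxE ?eqxx ?mulr1 // => k /negPf kb.
  by rewrite mxE kb mulr0.
under eq_bigr do under eq_bigr do rewrite !mulmxA -[_ *m Y *m _]mulmxA MdN.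
have ->: X *m P *m Y^T *m Q = X *m (Y *m P^T)^T *m Q.
  by rewrite trmx_mul trmxK !mulmxA.
rewrite mxtrace_mulC mulmxA exchange_big /=; apply: eq_bigr => d _.
by rewrite mxE; apply: eq_bigr => b _; rewrite !mxE.
Qed.

Variables (gT : finGroupType) (G : {group gT}).

(** The row space of [f] is a nonzero submodule, hence everything. With [tau] a bare function, this
    covers both [x |-> (rG x^-1)^T] and [rG \o alpha]. *)
Lemma mx_irr_intertwiner_unit (F : fieldType) n (rG : mx_representation F G n)
    (tau : gT -> 'M[F]_n) (f : 'M[F]_n) :
    mx_irreducible rG -> {in G, forall x, f *m rG x = tau x *m f} ->
  f != 0 -> f \in unitmx.
Proof.
case/mx_irrP=> _ irr Hf nz; rewrite -row_full_unit; apply: irr nz.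
by apply/mxmoduleP=> x Gx; rewrite Hf // submxMl.
Qed.

(** Schur: the sum commutes with [rG], hence is scalar, and its trace determines the scalar. *)
Lemma sum_conj_abs_irr (F : numFieldType) n (rG : mx_representation F G n)
    (E : 'M[F]_n) : mx_absolutely_irreducible rG ->
  \sum_(g in G) rG g *m E *m rG g^-1%g = (#|G|%:R / n%:R * \tr E)%:M.
Proof.
move=> absG; have n_gt0 : (0 < n)%N by case/andP: absG.
set A := LHS.
have /(mx_abs_irr_cent_scalar absG)/is_scalar_mxP[a Aa] : centgmx rG A.
  apply/centgmxP => x Gx; rewrite mulmx_suml mulmx_sumr.
  rewrite (reindex_inj (mulgI x)) /=; apply: eq_big => [g|g Gg].
    by rewrite groupMl.
  have {}Gg: g \in G by rewrite groupMl in Gg.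
  by rewrite invMg !repr_mxM ?groupV // !mulmxA repr_mxKV.
rewrite Aa; congr (_%:M).
have: \tr A = \tr E *+ #|G|.
  rewrite raddf_sum -sumr_const; apply: eq_bigr => g Gg /=.
  by rewrite mxtrace_mulC mulmxA -repr_mxM ?groupV // mulVg repr_mx1 mul1mx.
rewrite Aa mxtrace_scalar => Ea.
have n_neq0 : n%:R != 0 :> F by rewrite pnatr_eq0 -lt0n.
by rewrite mulrAC; apply/(canRL (mulfK n_neq0)); rewrite mulr_natr mulr_natl.
Qed.

Variables (R : realFieldType) (n : nat) (rG : mx_representation R G n).

(** Gram matrix of the standard scalar product averaged over [G], so that
    [(rG x)^T *m B *m rG x = B] for [x] in [G]. *)
Let B : 'M[R]_n := \sum_(g in G) (rG g)^T *m rG g.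

Lemma mxtrace_trmx_mul_ge0 m p (X : 'M[R]_(m, p)) : 0 <= \tr (X^T *m X).
Proof.
apply: sumr_ge0 => i _; rewrite mxE; apply: sumr_ge0 => j _.
by rewrite mxE -expr2 sqr_ge0.
Qed.

Lemma invariant_form_sym : B^T = B.
Proof.
by rewrite raddf_sum; apply: eq_bigr => g _ /=; rewrite trmx_mul trmxK.
Qed.

Lemma invariant_form_repr x : x \in G -> B *m rG x = (rG x^-1%g)^T *m B.
Proof.
move=> Gx; rewrite mulmx_suml mulmx_sumr [RHS](reindex_inj (mulIg x)) /=.
apply: eq_big => [g|g Gg]; first by rewrite groupMr.
rewrite !repr_mxM // trmx_mul !mulmxA -trmx_mul -repr_mxM ?groupV //.
by rewrite mulgV repr_mx1 trmx1 mul1mx.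
Qed.

Hypothesis absG : mx_absolutely_irreducible rG.

Let n_gt0 : (0 < n)%N. Proof. by case/andP: absG. Qed.

(** [B] intertwines [rG] with its dual, and it is nonzero: the summand at [1] has trace [n] and the
    others have nonnegative trace. *)
Lemma invariant_form_unit : B \in unitmx.
Proof.
apply: (@mx_irr_intertwiner_unit _ _ rG (fun x => (rG x^-1%g)^T)).
- exact: mx_abs_irrW.
- exact: invariant_form_repr.
apply/eqP => B0; have: 0 < \tr B; last by rewrite B0 mxtrace0 ltxx.
rewrite /B (bigD1 1%g) //= repr_mx1 trmx1 mul1mx mxtraceD mxtrace1.
rewrite ltr_pwDl ?ltr0n // raddf_sum sumr_ge0 // => g _.
exact: mxtrace_trmx_mul_ge0.
Qed.

Let Bu := invariant_form_unit.

Lemma trmx_inv_invariant_form : (invmx B)^T = invmx B.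
Proof. by rewrite trmx_inv invariant_form_sym. Qed.

(** The adjoint of [X] for the scalar product [B]: [B *m adj X = X^T *m B]. *)
Let adj (X : 'M[R]_n) := invmx B *m X^T *m B.

Lemma mxtrace_adj X : \tr (adj X) = \tr X.
Proof. by rewrite mxtrace_mulC mulKVmx // mxtrace_tr. Qed.

(* Both [B] and its inverse [B^-1 B B^-1] are Gram matrices, so that the trace
   is a sum of squared Frobenius norms. *)
Lemma mxtrace_adj_mul_ge0 X : 0 <= \tr (adj X *m X).
Proof.
have BE : B = \sum_(g in G) (rG g)^T *m rG g by [].
have BV : invmx B = \sum_(g in G) (rG g *m invmx B)^T *m (rG g *m invmx B).
  transitivity (invmx B *m B *m invmx B); first by rewrite mulVmx ?mul1mx.
  rewrite {2}BE mulmx_sumr mulmx_suml; apply: eq_bigr => g _.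
  by rewrite trmx_mul trmx_inv_invariant_form !mulmxA.
have trB M N :
    \tr (M *m B *m N) = \sum_(h in G) \tr (M *m ((rG h)^T *m rG h) *m N).
  by rewrite BE mulmx_sumr mulmx_suml raddf_sum.
have -> : \tr (adj X *m X) = \sum_(g in G) \sum_(h in G)
   \tr ((rG h *m X *m (rG g *m invmx B)^T)^T *m (rG h *m X *m (rG g *m invmx B)^T)).
  rewrite /adj {1}BV !mulmx_suml raddf_sum; apply: eq_bigr => g _ /=.
  rewrite trB; apply: eq_bigr => h _.
  move: (rG g *m invmx B) => K.
  by rewrite [in RHS]mulmxA [RHS]mxtrace_mulC !trmx_mul trmxK !mulmxA.
by apply: sumr_ge0 => g _; apply: sumr_ge0 => h _; apply: mxtrace_trmx_mul_ge0.
Qed.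

(** Orthogonality of [rG] for [B]; it trades [rG g] for a transposed [rG g^-1], the shape needed for
    Schur averages. *)
Lemma repr_adj x : x \in G -> rG x = adj (rG x^-1%g).
Proof.
by move=> Gx; rewrite /adj -mulmxA -invariant_form_repr // mulKmx.
Qed.

Lemma sum_mxtrace_intertwine (U : 'M[R]_n) (tau : gT -> 'M[R]_n) :
    U \in unitmx -> {in G, forall x, U *m rG x = tau x *m U} ->
  \sum_(g in G) \tr (tau g *m rG g)
    = #|G|%:R / n%:R * \tr (invmx U *m adj U).
Proof.
move=> Uu tauU.
(* Both come from rotating [U *m rG g *m invmx U *m adj (rG g^-1)] cyclically under the trace. *)
pose P := invmx U *m invmx B; pose Q := B *m U.
have ->: \sum_(g in G) \tr (tau g *m rG g)
  = \sum_(g in G) \tr (rG g *m P *m (rG g^-1%g)^T *m Q).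
  apply: eq_bigr => g Gg.
  have -> : tau g = U *m rG g *m invmx U by rewrite tauU // mulmxK.
  rewrite [X in \tr (_ *m X) = _]repr_adj // /adj /P /Q !mulmxA.
  by rewrite [RHS]mxtrace_mulC !mulmxA.
under eq_bigr do rewrite mxtrace_mul_trmx_delta.
rewrite exchange_big /=; under eq_bigr do rewrite exchange_big /=.
transitivity (\sum_b \sum_d #|G|%:R / n%:R * (b == d)%:R * (Q *m P^T) d b).
  apply: eq_bigr => b _; apply: eq_bigr => d _.
  (* The average of [delta_mx b d] is scalar and vanishes unless [b = d], which leaves a trace. *)
  rewrite -summxE -mulmx_suml -mulmx_sumr sum_conj_abs_irr //.
  by rewrite mul_mx_scalar -scalemxAl mxE mxtrace_delta.
have -> : \tr (invmx U *m adj U) = \tr (Q *m P^T).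
  rewrite -[RHS]mxtrace_tr trmx_mul trmxK /P /Q trmx_mul invariant_form_sym.
  by rewrite !mulmxA.
rewrite mulr_sumr; apply: eq_bigr => b _.
rewrite (bigD1 b) //= big1 => [|d /negPf bd]; last first.
  by rewrite eq_sym bd mulr0 mul0r.
by rewrite eqxx mulr1 addr0.
Qed.

(** The Frobenius-Schur indicator is [1]: take the intertwiner [U = 1], which is its own adjoint. *)
Lemma sum_mxtrace_sqr : \sum_(g in G) \tr (rG g *m rG g) = #|G|%:R.
Proof.
rewrite (@sum_mxtrace_intertwine 1%:M) ?unitmx1 // => [|x _]; last first.
  by rewrite mul1mx mulmx1.
rewrite /adj trmx1 mulmx1 mulVmx // invmx1 mulmx1 mxtrace1 divfK //.
by rewrite pnatr_eq0 -lt0n.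
Qed.

(* The adjoint of an intertwiner [U] is [c U^-1] with [c > 0], so [U] is
   orthogonal up to scaling; the bound is [0 <= tr ((U - adj U)^adj (U - adj U))]. *)
Lemma mxtrace_intertwiner_le (U : 'M[R]_n) (tau : gT -> 'M[R]_n) :
  U \in unitmx -> {in G, forall x, U *m rG x = tau x *m U} ->
  (forall x, x \in G -> B *m tau x = (tau x^-1%g)^T *m B) ->
  \tr (invmx U *m adj U) <= n%:R.
Proof.
move=> Uu tauU tauB.
have /(mx_abs_irr_cent_scalar absG)/is_scalar_mxP[c Uc] : centgmx rG (adj U *m U).
  apply/centgmxP => x Gx.
  have rGV : rG x *m invmx B = invmx B *m (rG x^-1%g)^T.
    rewrite -[RHS](mulmxK Bu) -[_ *m _ *m B]mulmxA -invariant_form_repr //.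
    by rewrite mulKmx.
  rewrite /adj -!mulmxA tauU // [B *m (_ *m _)]mulmxA tauB // -mulmxA.
  rewrite [U^T *m (_ *m _)]mulmxA -trmx_mul -tauU ?groupV //.
  by rewrite trmx_mul !mulmxA rGV.
have adjU : adj U = c *: invmx U by rewrite -[LHS](mulmxK Uu) Uc mul_scalar_mx.
have [c0 | c_neq0] := eqVneq c 0.
  by rewrite adjU c0 scale0r mulmx0 mxtrace0 ler0n.
have c_gt0 : 0 < c.
  have := mxtrace_adj_mul_ge0 U; rewrite Uc mxtrace_scalar.
  by rewrite pmulrn_lge0 // le0r (negPf c_neq0).
have adjB : adj (U - adj U) = adj U - U.
  rewrite {1}/adj raddfB /= mulmxBr mulmxBl; congr (_ - _).
  rewrite /adj !trmx_mul trmxK trmx_inv_invariant_form invariant_form_sym.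
  by rewrite mulKmx // mulmxKV.
have tr_sqr : \tr (U *m U) = \tr (adj U *m adj U).
  rewrite -mxtrace_adj /adj trmx_mul !mulmxA; congr (\tr (_ *m _)).
  by rewrite mulmxK.
(* This trace expands to twice [c * n - c * \tr (invmx U *m adj U)]; then divide by [c > 0]. *)
have := mxtrace_adj_mul_ge0 (U - adj U).
have UadjU : U *m adj U = c%:M by rewrite adjU -scalemxAr mulmxV // scalemx1.
rewrite adjB mulmxBl !mulmxBr Uc UadjU opprB addrACA !raddfD /= !raddfN /=.
have tr_adj2 : \tr (adj U *m adj U) = c * \tr (invmx U *m adj U).
  by rewrite {1}adjU -scalemxAl mxtraceZ.
rewrite tr_sqr tr_adj2 mxtrace_scalar -!mulr2n.
rewrite -mulrnDl pmulrn_lge0 // subr_ge0 -[c *+ n]mulr_natr.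
by rewrite ler_pM2l.
Qed.

(** Either some average of a matrix unit is nonzero, hence an invertible intertwiner to which the
    bound applies, or all vanish and the sum is [0]. *)
Lemma sum_mxtrace_twist_le (alpha : {perm gT}) : alpha \in Aut G ->
  \sum_(g in G) \tr (rG (alpha g) *m rG g) <= #|G|%:R.
Proof.
move=> autA; have Galpha x : x \in G -> alpha x \in G.
  by move=> Gx; rewrite -(autmE autA) Aut_closed.
have alphaM : {in G &, {morph alpha : x y / (x * y)%g}}.
  by move=> x y Gx Gy; rewrite -!(autmE autA) morphM.
have alphaV x : x \in G -> alpha x^-1%g = (alpha x)^-1%g.
  by move=> Gx; rewrite -!(autmE autA) morphV.
pose avg (E : 'M[R]_n) := \sum_(g in G) rG (alpha g) *m E *m rG g^-1%g.
have avgP E : {in G, forall x, avg E *m rG x = rG (alpha x) *m avg E}.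
  move=> x Gx; rewrite mulmx_suml mulmx_sumr (reindex_inj (mulgI x)) /=.
  apply: eq_big => [g|g Gg]; first by rewrite groupMl.
  have {}Gg: g \in G by rewrite groupMl in Gg.
  rewrite invMg alphaM // !repr_mxM ?groupV ?Galpha // !mulmxA.
  by rewrite repr_mxKV.
have [/forallP avg0 | ] :=
    boolP [forall b, forall d, avg (delta_mx b d) == 0]; last first.
  case/forallPn=> b /forallPn[d nz].
  have Uu : avg (delta_mx b d) \in unitmx.
    exact: mx_irr_intertwiner_unit (mx_abs_irrW absG) (avgP _) nz.
  rewrite (sum_mxtrace_intertwine _ _ Uu (avgP _)).
  have n0 : 0 < n%:R :> R by rewrite ltr0n.
  rewrite mulrAC ler_pdivrMr // ler_wpM2l ?ler0n //.
  apply: mxtrace_intertwiner_le Uu (avgP _) _ => x Gx.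
  by rewrite invariant_form_repr ?Galpha // alphaV.
have -> : \sum_(g in G) \tr (rG (alpha g) *m rG g) = 0; last exact: ler0n.
transitivity (\sum_(g in G)
    \tr (rG (alpha g) *m invmx B *m (rG g^-1%g)^T *m B)).
  apply: eq_bigr => g Gg.
  by rewrite [X in \tr (_ *m X) = _]repr_adj // /adj !mulmxA.
under eq_bigr do rewrite mxtrace_mul_trmx_delta.
rewrite exchange_big big1 //= => b _; rewrite exchange_big big1 //= => d _.
rewrite -summxE -mulmx_suml -mulmx_sumr.
have /forallP/(_ d)/eqP := avg0 b; rewrite /avg => ->.
by rewrite mulmx0 mul0mx mxE.
Qed.

End RealRepresentation.

(** * Counting inverted elements with the regular character *)

Section CountInverted.

Import Order.TTheory GRing.Theory Num.Theory.
Local Open Scope ring_scope.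

Variables (gT : finGroupType) (G : {group gT}) (alpha : {perm gT}).
Hypothesis autA : alpha \in Aut G.

Lemma mxtrace_regular_repr (F : fieldType) x :
  x \in G -> \tr (regular_repr F G x) = #|G|%:R *+ (x == 1%g).
Proof.
move=> Gx; have [-> | ntx] := eqVneq x 1%g; first by rewrite repr_mx1 mxtrace1.
rewrite [\tr _]big1 // => i _; rewrite 2!mxE /=.
rewrite -(inj_eq enum_val_inj) gring_indexK ?groupM ?enum_valP //.
by rewrite eq_mulVg1 mulKg (negbTE ntx).
Qed.

Lemma card_inverted_set (C : numClosedFieldType) (sG : irrType C G) :
  (#|G| * #|inverted_set G alpha|)%:R
    = \sum_(i : sG)
        (\sum_(g in G) \tr (irr_repr i (alpha g * g)%g)) *+ irr_degree i.
Proof.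
have Galpha x : x \in G -> alpha x \in G.
  by move=> Gx; rewrite -(autmE autA) Aut_closed.
have C'G : [pchar C]^'.-group G.
  by apply/pgroupP => p _ _; rewrite inE /= pchar_num.
transitivity (\sum_(g in G) \tr (regular_repr C G (alpha g * g)%g)).
  (* The regular character is supported at [1], and [alpha g * g = 1] says that [alpha] inverts
     [g]. *)
  under eq_bigr => g Gg do rewrite mxtrace_regular_repr ?groupM ?Galpha // mulrb.
  rewrite -big_mkcondr sumr_const natrM mulr_natr; congr (_ *+ _).
  apply: eq_card => g; rewrite !inE; congr (_ && _).
  by rewrite eq_mulgV1 invgK.
under eq_bigr => g Gg do
  rewrite (mxtrace_regular_pchar sG C'G (@group_closure_closed_field _ _ G))
    ?groupM ?Galpha //.
by rewrite exchange_big; apply: eq_bigr => i _; rewrite -sumrMnl.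
Qed.

End CountInverted.

(** * Descent to real forms and comparison of the two counts *)

Section Realizable.

Import Order.TTheory GRing.Theory Num.Theory.
Local Open Scope ring_scope.

(** Both sums are images of real sums over the real form. The bound [#|G|] is written as the sum at
    the identity automorphism, so that the two counts compare term by term. *)
Lemma sum_mxtrace_realizable_le (R : realType) (gT : finGroupType)
    (G : {group gT}) (alpha : {perm gT}) n (rG : mx_representation R[i] G n) :
    alpha \in Aut G -> mx_irreducible rG -> realizable_over_reals rG ->
  \sum_(g in G) \tr (rG (alpha g * g)%g)
    <= \sum_(g in G) \tr (rG ((1%g : {perm gT}) g * g)%g).
Proof.
move=> autA irrG [m [rR simG]].
(* [R[i]] is algebraically closed, so irreducible means absolutely irreducible there, and this
   descends to the real form. *)
have absR : mx_absolutely_irreducible rR.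
  rewrite -(map_mx_abs_irr (real_complex R)) -(mx_rsim_abs_irr simG).
  exact: group_closure_closed_field.
have sumE (beta : {perm gT}) : beta \in Aut G ->
    \sum_(g in G) \tr (rG (beta g * g)%g)
      = real_complex R (\sum_(g in G) \tr (rR (beta g) *m rR g)).
  move=> autB; rewrite rmorph_sum; apply: eq_bigr => g Gg.
  have Gb : beta g \in G by rewrite -(autmE autB) Aut_closed.
  by rewrite (mxtrace_rsim simG) ?groupM //= trace_map_mx repr_mxM.
rewrite !sumE ?group1 // lecR.
under [leRHS]eq_bigr do rewrite perm1.
by rewrite sum_mxtrace_sqr // sum_mxtrace_twist_le.
Qed.

Lemma card_inverted_set_le (R : realType) (gT : finGroupType)
    (G : {group gT}) (alpha : {perm gT}) :
    alpha \in Aut G ->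
    (forall n (rG : mx_representation R[i] G n),
       mx_irreducible rG -> realizable_over_reals rG) ->
  (#|inverted_set G alpha| <= #|inverted_set G 1%g|)%N.
Proof.
move=> autA real; rewrite -(leq_pmul2l (cardG_gt0 G)) -(ler_nat R[i]).
pose sG : irrType R[i] G := DecSocleType (regular_repr R[i] G).
rewrite (card_inverted_set _ _ _ autA _ sG).
rewrite (card_inverted_set _ _ _ (group1 _) _ sG).
apply: ler_sum => i _; apply: ler_wMn2r.
have irr_i := socle_irr i.
exact: sum_mxtrace_realizable_le autA irr_i (real _ _ irr_i).
Qed.

End Realizable.

Theorem corollary3p2 (R : realType) (gT : finGroupType) (G : {group gT})
    (alpha : {perm gT}) (Halpha : alpha \in Aut G)
    (Hcard : (#|inverted_set G 1| < #|inverted_set G alpha|)%N) :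
  exists (n : nat) (rG : mx_representation R[i] G n),
    mx_irreducible rG /\ ~ realizable_over_reals rG.
Proof.
apply: contrapT => nonreal.
have real n (rG : mx_representation R[i] G n) :
    mx_irreducible rG -> realizable_over_reals rG.
  by move=> irrG; apply: contrapT => nr; apply: nonreal; exists n, rG.
by move: Hcard; rewrite ltnNge (card_inverted_set_le R).
Qed.
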